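(* Let $k$ be a nonnegative integer. Then the edges of every digraph in $\mathscr{D}(k,k)$ can be covered by at most $c(2k+1)+1$ directed cuts.
   Context: Digraphs are finite directed graphs without loops and without parallel edges (two edges $uv$ and $vu$ in opposite directions between the same pair of vertices are allowed). $V(D)$ and $E(D)$ denote the vertex set and edge set of $D$; $uv$ denotes an edge directed from $u$ to $v$. For nonnegative integers $k$ and $l$, $\mathscr{D}(k,l)$ denotes the family of digraphs in which every vertex has either indegree at most $k$ or outdegree at most $l$. For a bipartition $(X,Y)$ of $V(D)$ (a partition of $V(D)$ into two disjoint, possibly empty, sets $X$ and $Y$), the directed cut induced by $(X,Y)$ is the edge set $E(X,Y)=\{xy\in E(D) : x\in X,\ y\in Y\}$. A family of directed cuts of $D$ covers the edges of $D$ if every edge of $D$ lies in at least one of the cuts. For a positive integer $n$, $c(n)=\min\{m : \binom{m}{\lfloor m/2\rfloor}\geq n\}$, the minimum being over nonnegative integers $m$. *)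

(* Defs.v *)
From mathcomp Require Import all_boot.

Set Implicit Arguments.
Unset Strict Implicit.
Unset Printing Implicit Defensive.

(* Loops are excluded by arc_irrefl, parallel edges by arc being a relation;
   opposite edges uv and vu may coexist. *)
Record digraph := Digraph {
  vertex : finType;
  arc : rel vertex;
  arc_irrefl : irreflexive arc
}.

Section Digraph.
Variable D : digraph.

Definition edges : {set vertex D * vertex D} := [set uv | arc uv.1 uv.2].

Definition indegree (v : vertex D) : nat := #|[set u | arc u v]|.
Definition outdegree (v : vertex D) : nat := #|[set w | arc v w]|.

Definition in_family_D (k l : nat) : Prop :=
  forall v : vertex D, indegree v <= k \/ outdegree v <= l.

Definition bipartition (X Y : {set vertex D}) : Prop :=
  X :|: Y = [set: vertex D] /\ [disjoint X & Y].

Definition cut_edges (X Y : {set vertex D}) : {set vertex D * vertex D} :=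
  [set xy in edges | (xy.1 \in X) && (xy.2 \in Y)].

Definition directed_cut (C : {set vertex D * vertex D}) : Prop :=
  exists X Y : {set vertex D}, bipartition X Y /\ C = cut_edges X Y.

Definition covers_edges (F : {set {set vertex D * vertex D}}) : Prop :=
  forall uv, uv \in edges -> exists2 C, C \in F & uv \in C.

End Digraph.

Lemma central_bin_unbounded (n : nat) : exists m, n <= 'C(m, m./2).
Proof.
exists n.*2; rewrite doubleK; apply: ltnW.
elim: n => [|n IHn]; first by rewrite bin0.
rewrite doubleS binS; apply: (@leq_add 1 n.+1).
  by rewrite bin_gt0 -addnn ltnS leq_addl.
case: n IHn => [|n] IHn; first by rewrite bin0.
by rewrite binS (leq_trans IHn) ?leq_addr.
Qed.

Definition c (n : nat) : nat := ex_minn (central_bin_unbounded n).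

(* Main.v *)
Require Import Defs.
From mathcomp Require Import all_boot.

(** Let [A] be the set of vertices of indegree at most [k]; every vertex outside
    [A] then has outdegree at most [k].  One cut, from [A] to its complement,
    disposes of all the edges leaving [A].

    Charge each of the remaining edges [uv] to [v] when [v] is in [A], and to
    [u] otherwise; in the latter case [u] is outside [A] too, since [uv] does not
    leave [A].  A vertex is charged with at most [k] edges, so every set [S] of
    vertices spans at most [k * #|S|] remaining edges and contains a vertex
    incident with at most [2 * k] of them: the remaining edges form a
    [2 * k]-degenerate graph, which is properly coloured with [2 * k + 1]
    colours ([few_charged_colouring]).

    Finally, a proper colouring with at most ['C(m, m./2)] colours gives [m] cuts
    covering all its edges ([half_sets_separate]): name the colours by distinct
    [m./2]-subsets of an [m]-set and let the [i]-th cut separate the vertices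
    whose colour contains [i] from the others.  Subsets of equal size form an
    antichain, so an edge is covered in whichever direction it points. *)

(** Distinct sets of the same size are never included in one another, which
    provides [i] for both orders of [a] and [b]. *)
Lemma half_sets_separate (n m : nat) : n <= 'C(m, m./2) ->
  exists g : 'I_n -> {set 'I_m},
    forall a b, a != b -> exists2 i, i \in g a & i \notin g b.
Proof.
set P := [set S : {set 'I_m} | #|S| == m./2] => le_n.
have cardP : #|P| = 'C(m, m./2) by rewrite card_draws card_ord.
have le_nP : n <= #|P| by rewrite cardP.
pose g (a : 'I_n) : {set 'I_m} := enum_val (widen_ord le_nP a).
have card_g a : #|g a| = m./2.
  by have := enum_valP (widen_ord le_nP a); rewrite inE => /eqP.
exists g => a b neq_ab; apply/subsetPn; apply: contra neq_ab => sub_ab.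
have /eqP eq_g : g a == g b by rewrite eqEcard sub_ab !card_g leqnn.
by apply/eqP/val_inj; move/enum_val_inj/(congr1 val): eq_g.
Qed.

(** The two degrees have the same sum over [S], and it is at most [k * #|S|]. *)
Lemma exists_low_degree (T : finType) (e : rel T) (k : nat) (S : {set T}) :
    (forall v, #|[set u | e v u]| <= k) -> S != set0 ->
  exists2 v, v \in S &
    #|[set u in S | e v u]| + #|[set u in S | e u v]| <= 2 * k.
Proof.
move=> le_k S_neq0; apply/exists_inP; apply: contraT.
rewrite negb_exists => /forallP big_deg.
have out_sum : \sum_(v in S) #|[set u in S | e v u]| <= k * #|S|.
  rewrite mulnC -sum_nat_const; apply: leq_sum => v _.
  apply: leq_trans (le_k v); apply: subset_leq_card.
  by apply/subsetP => u; rewrite !inE => /andP[].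
have in_sum : \sum_(v in S) #|[set u in S | e u v]|
            = \sum_(v in S) #|[set u in S | e v u]|.
  have cardE (r : rel T) v :
      #|[set u in S | r v u]| = \sum_(u in S) (r v u : nat).
    by rewrite -sum1dep_card big_mkcondr; apply: eq_bigr => u _; case: (r v u).
  under eq_bigr => v _ do rewrite (cardE (fun x y => e y x)).
  by rewrite exchange_big; apply: eq_bigr => v _; rewrite cardE.
have: #|S| * (2 * k).+1 <= 2 * k * #|S|.
  rewrite -sum_nat_const -mulnA [leqRHS]mul2n -addnn.
  apply: leq_trans (leq_add out_sum out_sum).
  rewrite -{2}in_sum -big_split; apply: leq_sum => v vS.
  by have := big_deg v; rewrite vS /= -ltnNge.
by rewrite [2 * k * _]mulnC leq_pmul2l ?ltnn // card_gt0.
Qed.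

(** [e v u] means that the edge joining [u] and [v] is charged to [v].  Induction
    on [S], as for any degenerate graph: delete a vertex of low degree, colour
    the rest and give that vertex a colour which none of its neighbours has. *)
Lemma few_charged_colouring (T : finType) (e : rel T) (k : nat) :
    irreflexive e -> (forall v, #|[set u | e v u]| <= k) ->
  exists f : T -> 'I_(2 * k + 1), forall u v, e u v -> f u != f v.
Proof.
move=> e_irr le_k; rewrite addn1.
suff colour (S : {set T}) : exists f : T -> 'I_(2 * k).+1,
    {in S &, forall u v, e u v -> f u != f v}.
  by have [f fP] := colour setT; exists f => u v; apply: fP; rewrite inE.
have [n] := ubnP #|S|; elim: n S => // n IHn S; rewrite ltnS => le_Sn.
have [->|S_neq0] := eqVneq S set0; first by exists (fun=> ord0) => u v; rewrite inE.
have [v vS low_v] := exists_low_degree _ _ _ _ le_k S_neq0.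
have [|f fP] := IHn (S :\ v); first by rewrite (cardsD1 v S) vS in le_Sn.
pose N := [set u in S | e v u] :|: [set u in S | e u v].
have [col colN] : exists col, col \notin f @: N.
  apply/existsP; apply: contraT; rewrite negb_exists => /forallP allN.
  have: #|'I_(2 * k).+1| <= #|f @: N|.
    by rewrite -cardsT; apply/subset_leq_card/subsetP => x _; apply/negPn/allN.
  rewrite card_ord leqNgt ltnS (leq_trans (leq_imset_card _ _)) //.
  by apply: leq_trans low_v; rewrite cardsU leq_subr.
have colP u : u \in N -> f u != col.
  by move=> uN; apply: contraNneq colN => <-; apply: imset_f.
exists (fun u => if u == v then col else f u) => x y xS yS exy.
have [xv|x_neq_v] := eqVneq x v; have [yv|y_neq_v] := eqVneq y v.
- by rewrite xv yv e_irr in exy.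
- by rewrite eq_sym; apply: colP; rewrite !inE yS -xv exy.
- by apply: colP; rewrite !inE xS -yv exy orbT.
- by apply: fP; rewrite // !inE ?x_neq_v ?y_neq_v.
Qed.

Lemma bin_c_ge (n : nat) : n <= 'C(c n, (c n)./2).
Proof. by rewrite /c; case: ex_minnP. Qed.

Lemma directed_cut_setC (D : digraph) (X : {set vertex D}) :
  directed_cut (cut_edges X (~: X)).
Proof.
exists X, (~: X); split=> //; split; first exact: setUCr.
by rewrite -setI_eq0 setICr.
Qed.

Theorem theorem3 (k : nat) (D : digraph) :
  in_family_D D k k ->
  exists F : {set {set vertex D * vertex D}},
    [/\ forall C, C \in F -> directed_cut C,
        covers_edges F
      & #|F| <= c (2 * k + 1) + 1].
Proof.
move=> Dk; pose A := [set v : vertex D | indegree v <= k].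
pose e (v u : vertex D) := if v \in A then Defs.arc u v else Defs.arc v u && (u \notin A).
have e_irr : irreflexive e by move=> v; rewrite /e arc_irrefl if_same.
have le_k v : #|[set u | e v u]| <= k.
  have [vA | vA] := boolP (v \in A).
    have le_in : indegree v <= k by rewrite inE in vA.
    apply: leq_trans le_in; apply/subset_leq_card/subsetP => u.
    by rewrite [in X in X -> _]inE /e vA inE.
  have [le_in | le_out] := Dk v; first by rewrite inE le_in in vA.
  apply: leq_trans le_out; apply/subset_leq_card/subsetP => u.
  by rewrite [in X in X -> _]inE /e (negPf vA) inE => /andP[].
have [f fP] := few_charged_colouring _ _ _ e_irr le_k.
have [g gP] := half_sets_separate _ _ (bin_c_ge (2 * k + 1)).
pose X i := [set v | i \in g (f v)].
exists (cut_edges A (~: A) |: [set cut_edges (X i) (~: X i) | i : 'I_(c (2 * k + 1))]).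
split.
- by move=> C /setU1P[-> | /imsetP[i _ ->]]; apply: directed_cut_setC.
- move=> [u v] uvE; have auv : Defs.arc u v by rewrite inE in uvE.
  have [/andP[uA vA] | not_AB] := boolP ((u \in A) && (v \notin A)).
    exists (cut_edges A (~: A)); first exact: setU11.
    by rewrite inE uvE /= uA inE vA.
  have f_neq : f u != f v.
    have [vA | vA] := boolP (v \in A).
      by rewrite eq_sym; apply: fP; rewrite /e vA.
    by apply: fP; rewrite /e auv vA andbT in not_AB *; rewrite (negPf not_AB).
  have [i iu iv] := gP _ _ f_neq.
  exists (cut_edges (X i) (~: X i)); first by apply/setU1r/imset_f.
  by rewrite inE uvE /= !inE iu iv.
- rewrite cardsU1 addnC leq_add ?leq_b1 //.
  by rewrite (leq_trans (leq_imset_card _ _)) // card_ord.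
Qed.
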